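(* Let $\Omega=(a,b)\subset\mathbb{R}$ be a bounded open interval, $f\in BV(\Omega)$, and $\alpha\in C(\overline{\Omega})$ with $\alpha>0$ on $\overline\Omega$ and $\alpha'\in BV(\Omega)$. Let $u$ be the solution of $$\min_{u\in BV(\Omega)}\ \frac12\int_\Omega (f-u)^2\,dx+\int_\Omega \alpha(x)\,d|Du| .$$ Suppose that $x\in\Omega$ is a jump discontinuity point of $f$ (i.e. $|Df|(\{x\})>0$) and that $D\alpha'(\{x\})>0$. Then $$|Du|(\{x\})\le |Df|(\{x\})+D\alpha'(\{x\}).$$
   Context: For $u\in BV(\Omega)$, $Du$ denotes its distributional derivative (a finite signed Radon measure) and $|Du|$ its total variation measure. The condition $\alpha'\in BV(\Omega)$ means that the weak derivative $\alpha'$ of $\alpha$ is a function of bounded variation; $D\alpha'$ is the distributional derivative of $\alpha'$. The minimisation problem has a unique solution. *)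

(* Defs.v *)
From HB Require Import structures.
From mathcomp Require Import all_boot all_order all_algebra.
From mathcomp Require Import all_classical all_reals all_analysis.
Set Implicit Arguments.
Unset Strict Implicit.
Unset Printing Implicit Defensive.
Import Order.TTheory GRing.Theory Num.Theory.
Import numFieldNormedType.Exports.

Local Open Scope classical_set_scope.
Local Open Scope ring_scope.

(* Finite signed Borel measures on the line; as R is locally compact and
   second countable, each of them is Radon. *)
Notation signed_measure R :=
  ({charge set (measurableTypeR R) -> \bar R})%R (only parsing).

Section signed_measures.
Context (R : realType).
Implicit Types nu : signed_measure R.

(* A choice of Hahn decomposition: the Jordan decomposition, and hence the
   total variation, do not depend on it. *)
Definition hahn_pos nu : set (measurableTypeR R) :=
  projT1 (cid (Hahn_decomposition nu)).

Definition hahn_neg nu : set (measurableTypeR R) :=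
  projT1 (cid (projT2 (cid (Hahn_decomposition nu)))).

Lemma hahnP nu : hahn_decomposition nu (hahn_pos nu) (hahn_neg nu).
Proof. exact: projT2 (cid (projT2 (cid (Hahn_decomposition nu)))). Qed.

Definition total_variation_measure nu
  : {measure set (measurableTypeR R) -> \bar R} :=
  charge_variation (hahnP nu).

Definition signed_integral nu (D : set R) (g : R -> R) : R :=
  \int[jordan_pos (hahnP nu)]_(x in D) g x
  - \int[jordan_neg (hahnP nu)]_(x in D) g x.

End signed_measures.

Section bounded_variation.
Context (R : realType).
Implicit Types (a b : R) (u v f g alpha phi : R -> R).

(* phi is in C_c^oo(]a, b[), extended by 0 outside ]a, b[ *)
Definition test_function a b phi : Prop :=
  [/\ forall n x, derivable (derive1n n phi) x 1,
      compact (closure [set x | phi x != 0]) &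
      closure [set x | phi x != 0] `<=` `]a, b[ ].

Definition weak_derivative a b u g : Prop :=
  [/\ locally_integrable `]a, b[ u,
      locally_integrable `]a, b[ g &
      forall phi, test_function a b phi ->
        \int[lebesgue_measure]_(x in `]a, b[) (u x * derive1 phi x)
        = - \int[lebesgue_measure]_(x in `]a, b[) (g x * phi x)].

(* u is in BV(]a, b[) and Du is its distributional derivative. A signed measure
   on ]a, b[ is encoded as one on the line that vanishes outside ]a, b[. *)
Definition BV_derivative a b u (Du : signed_measure R) : Prop :=
  [/\ lebesgue_measure.-integrable `]a, b[ (EFin \o u),
      forall A : set (measurableTypeR R), measurable A ->
        A `&` `]a, b[ = set0 -> Du A = 0%E &
      forall phi, test_function a b phi ->
        \int[lebesgue_measure]_(x in `]a, b[) (u x * derive1 phi x)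
        = - signed_integral Du `]a, b[ phi].

Definition energy a b f alpha u (Du : signed_measure R) : \bar R :=
  ((2^-1)%:E * \int[lebesgue_measure]_(x in `]a, b[) (((f x - u x) ^+ 2)%:E)
   + \int[total_variation_measure Du]_(x in `]a, b[) ((alpha x)%:E))%E.

Definition minimiser a b f alpha u (Du : signed_measure R) : Prop :=
  BV_derivative a b u Du /\
  forall v (Dv : signed_measure R), BV_derivative a b v Dv ->
    (energy a b f alpha u Du <= energy a b f alpha v Dv)%E.

End bounded_variation.

(* Main.v *)
(** The jump of [u] at [x] may be split, at a cost that minimality makes
    nonnegative.  Let [D = Du {x}], which we may assume nonzero, and
    [s = sgn D].  For [p != x] and [q] between [0] and [D], the competitor
    [u + q * (1_(p < y) - 1_(x < y))] has derivative
    [Du + q * delta_p - q * delta_x], of weighted total variation at most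
    that of [Du] plus [`|q| * (alpha p - alpha x)].  Letting [q] tend to [0],
    with [window p x y = 1_(p < y) - 1_(x < y)], we get
      [s * int (u - f) * window p x >= alpha x - alpha p
                                     = int alpha' * window p x].
    Adding up the cases [p = x - h] and [p = x + h] yields the slope of the
    tent of height [h] centred at [x].  Integrating by parts turns the sum
    into an inequality between the integrals of that tent against [s * Du] on
    one side and [s * Df + Dalpha'] on the other.  Divided by [h], the tents
    converge pointwise to the indicator of [{x}] as [h] tends to [0], hence
      [s * Du {x} <= s * Df {x} + Dalpha' {x}].
    Test functions being smooth, the tents are approximated by primitives of
    bumps built from [exp (- 1 / t)]. *)

Require Import Defs.
From mathcomp Require Import all_boot all_order all_algebra.
From mathcomp Require Import all_classical all_reals all_analysis.
From mathcomp Require Import measurable_realfun ring lra.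
Import Order.TTheory GRing.Theory Num.Theory.
Import numFieldNormedType.Exports.
Local Open Scope classical_set_scope.
Local Open Scope ring_scope.
Set Implicit Arguments.
Unset Strict Implicit.
Unset Printing Implicit Defensive.

(** * Smooth flat functions *)

Section smooth_functions.
Context (R : realType).
Implicit Types (f g F : R -> R) (k n : nat).

Definition smooth f := forall n x, derivable (derive1n n f) x 1.

(** The factor [s ^- k] is carried along so that derivatives stay in the family: differentiating the
    member of index [k] only produces those of indices [k.+1] and [k.+2]. *)
Definition flat_exp k (s : R) : R :=
  if 0 < s then s ^- k * expR (- s^-1) else 0.

Lemma flat_exp_ge0 k s : 0 <= flat_exp k s.
Proof.
rewrite /flat_exp; case: ifPn => // s0.
by rewrite mulr_ge0 ?expR_ge0// invr_ge0 exprn_ge0// ltW.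
Qed.

Lemma flat_exp_le0 k s : s <= 0 -> flat_exp k s = 0.
Proof. by move=> s0; rewrite /flat_exp ltNge s0. Qed.

Lemma flat_exp0_le1 s : flat_exp 0 s <= 1.
Proof.
rewrite /flat_exp; case: ifPn => // s0.
by rewrite expr0 invr1 mul1r expR_le1 oppr_le0 invr_ge0 ltW.
Qed.

Lemma flat_expS k s : flat_exp k s = flat_exp k.+1 s * s.
Proof.
rewrite /flat_exp; case: ifPn => [s0|]; last by rewrite mul0r.
by rewrite exprS; field; rewrite ?expf_eq0 ?gt_eqF ?andbF.
Qed.

Lemma flat_exp_le k s : flat_exp k s <= k.+1`!%:R * `|s|.
Proof.
rewrite /flat_exp; case: ifPn => [s0|_]; last by rewrite mulr_ge0.
rewrite gtr0_norm// expRN ler_pdivrMl ?exprn_gt0//.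
have si0 : 0 <= s^-1 by rewrite invr_ge0 ltW.
have := expR_ge1Dxn k si0 => /(le_trans _) le1.
rewrite invf_ple ?posrE ?expR_gt0//; last first.
  by rewrite !mulr_gt0 ?exprn_gt0// ltr0n fact_gt0.
apply: le1; rewrite exprVn.
rewrite [leLHS](_ : _ = (s ^+ k.+1)^-1 / k.+1`!%:R) ?lerDr//.
by rewrite -invfM exprSr; congr (_^-1); ring.
Qed.

Lemma continuous_flat_exp k : {for 0, continuous (flat_exp k)}.
Proof.
rewrite /prop_for /continuous_at flat_exp_le0//.
apply/(@cvgr0Pnorm_lt _ R R) => e e0.
have K0 : (0 : R) < k.+1`!%:R by rewrite ltr0n fact_gt0.
near=> s; rewrite ger0_norm ?flat_exp_ge0//.
rewrite (le_lt_trans (flat_exp_le k s))// mulrC -ltr_pdivlMr//.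
near: s; apply: (@nbhs0_lt R R); exact: divr_gt0.
Unshelve. all: by end_near. Qed.

Lemma is_derive_flat_exp k (s : R) :
  is_derive s 1 (flat_exp k) (flat_exp k.+2 s - k%:R * flat_exp k.+1 s).
Proof.
have [s0|s0|->] := ltgtP s 0.
- rewrite !flat_exp_le0 ?ltW// mulr0 subr0.
  apply: (@near_eq_is_derive _ _ _ (cst 0)).
  by near=> t; rewrite /cst flat_exp_le0// ltW//; near: t; exact: lt_nbhsl.
- pose E (t : R) := (t ^+ k)^-1 * expR (- t^-1).
  suff dE : is_derive s 1 E (flat_exp k.+2 s - k%:R * flat_exp k.+1 s).
    apply: (near_eq_is_derive _ dE); near=> t; rewrite /E /flat_exp ifT//.
    near: t; exact: lt_nbhsr.
  have sN0 : s != 0 by rewrite gt_eqF.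
  have d1 : is_derive s 1 (fun t : R => (t ^+ k)^-1) (- k%:R * s ^- k.+1).
    have dX : is_derive s 1 (fun t : R => t ^+ k) (k%:R * s ^+ k.-1).
      have := @is_deriveX R R id k s 1 1 (is_derive_id _ _).
      by rewrite exprfctE /GRing.scale/= mulr1.
    have skN0 : s ^+ k != 0 by rewrite expf_neq0.
    have [dk Dk] := dX.
    split; first exact: derivableV.
    rewrite deriveV// Dk /GRing.scale/=.
    (* The case [k = 0] is apart because [k.-1] is then truncated to 0; the factor [k%:R] vanishes
       there. *)
    case: k {E dX dk Dk} skN0 => [|k] _; first by rewrite !mul0r oppr0 mul0r mulr0.
    rewrite /= !exprS; field; rewrite ?expf_neq0//.
  have d2 : is_derive s 1 (fun t : R => expR (- t^-1)) (expR (- s^-1) * s ^- 2).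
    apply: is_derive1_comp.
    have dV : is_derive s 1 (fun t : R => t^-1) (- s ^- 2).
      split; first by apply: derivableV => //; exact: derivable_id.
      by rewrite deriveV// derive_id /GRing.scale/= mulr1.
    have := is_deriveN dV; rewrite opprK; exact.
  apply: (is_derive_eq (is_deriveM d1 d2)); rewrite /GRing.scale/= /flat_exp s0 !exprS.
  field; rewrite ?expf_neq0//.
- rewrite !(flat_exp_le0 _ (lexx 0)) mulr0 subr0.
  (* At 0, Caratheodory's criterion applies: [flat_exp k s = flat_exp k.+1 s * s], so the slope
     function is [flat_exp k.+1], continuous at 0 with value 0. *)
  apply/is_derive1_caratheodory; exists (flat_exp k.+1); split.
  + by move=> z; rewrite (flat_exp_le0 k (lexx 0)) !subr0 flat_expS.
  + exact: continuous_flat_exp.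
  + exact: flat_exp_le0.
Unshelve. all: by end_near. Qed.

(* Stable under differentiation, hence made of smooth functions; it contains
   the bumps below. *)
Inductive flat_alg : (R -> R) -> Prop :=
| flat_alg_exp k (m q : R) : flat_alg (fun x => flat_exp k (m * x + q))
| flat_algD f g : flat_alg f -> flat_alg g -> flat_alg (fun x => f x + g x)
| flat_algM f g : flat_alg f -> flat_alg g -> flat_alg (fun x => f x * g x)
| flat_algZ (c : R) f : flat_alg f -> flat_alg (fun x => c * f x).

Lemma flat_alg_derive f : flat_alg f ->
  exists2 g, flat_alg g & forall x : R, is_derive x 1 f (g x).
Proof.
elim=> [k m q|{}f g _ [f' Sf' df] _ [g' Sg' dg]|
        {}f g Sf [f' Sf' df] Sg [g' Sg' dg]|c {}f _ [f' Sf' df]].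
- exists (fun x => m * (flat_exp k.+2 (m * x + q) +
                        (- k%:R) * flat_exp k.+1 (m * x + q))).
    by apply: flat_algZ; apply: flat_algD; [|apply: flat_algZ];
       exact: flat_alg_exp.
  move=> x; rewrite mulrC mulNr.
  apply: is_derive1_comp; first exact: is_derive_flat_exp.
  rewrite -[X in is_derive _ _ _ X]addr0; apply: is_deriveD.
  have := @is_deriveZ R R R id m x 1 1 (is_derive_id _ _).
  by rewrite /GRing.scale/= mulr1.
- exists (fun x => f' x + g' x); first exact: flat_algD.
  by move=> x; exact: is_deriveD.
- exists (fun x => f x * g' x + g x * f' x).
    by apply: flat_algD; exact: flat_algM.
  by move=> x; exact: is_deriveM.
- exists (fun x => c * f' x); first exact: flat_algZ.
  by move=> x; exact: is_deriveZ.
Qed.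

Lemma flat_alg_smooth f : flat_alg f -> smooth f.
Proof.
move=> Sf n; suff [g Sg ->] : exists2 g, flat_alg g & derive1n n f = g.
  by have [g' _ dg] := flat_alg_derive Sg => x; exact: ex_derive.
elim: n => [|n [g Sg IH]]; first by exists f.
have [g' Sg' dg] := flat_alg_derive Sg; exists g' => //.
by rewrite derive1nS IH; apply/funext => x; rewrite derive1E derive_val.
Qed.

(** Meant for primitives of bumps, whose derivatives are known to lie in [flat_alg]. *)
Lemma smooth_primitive f F :
  smooth f -> (forall x : R, is_derive x 1 F (f x)) -> smooth F.
Proof.
move=> sf dF; case=> [|n] x; first exact: ex_derive.
rewrite derive1Sn (_ : derive1 F = f); first exact: sf.
by apply/funext => y; rewrite derive1E derive_val.
Qed.

Lemma derivable_continuous f : (forall x : R, derivable f x 1) -> continuous f.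
Proof. by move=> df x; apply: differentiable_continuous; exact/derivable1_diffP. Qed.

Lemma smooth_continuous f n : smooth f -> continuous (derive1n n f).
Proof. by move=> sf; apply: derivable_continuous; exact: sf. Qed.

End smooth_functions.

(** * Dominated convergence and signed measures *)

Section dominated_convergence_bounded.
Context d (T : measurableType d) (R : realType).
Variable mu : {measure set T -> \bar R}.
Implicit Types (D : set T) (w g : T -> R).

Lemma integrable_mul_bounded D w g (M : R) : measurable D ->
  mu.-integrable D (EFin \o w) -> measurable_fun D g ->
  (forall x, D x -> `|g x| <= M) ->
  mu.-integrable D (EFin \o (fun x => w x * g x)).
Proof.
move=> mD iw mg gM.
have mw : measurable_fun D w by apply/measurable_EFinP; exact: measurable_int iw.
apply: (le_integrable mD _ _ (integrableZl mD M iw)).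
  by apply/measurable_EFinP; exact: measurable_funM.
move=> x Dx /=; rewrite lee_fin !normrM mulrC ler_wpM2r//.
by rewrite (le_trans (gM _ Dx))// ler_norm.
Qed.

(** Dominated convergence with dominating function [|M * w|]. The weight [w] allows both integrable
    functions against Lebesgue measure and, with [w = 1], finite measures. *)
Lemma bounded_Rintegral_cvg D w (g_ : nat -> T -> R) g (M : R) :
  measurable D -> mu.-integrable D (EFin \o w) ->
  (forall n, measurable_fun D (g_ n)) ->
  (forall n x, D x -> `|g_ n x| <= M) ->
  (forall x, D x -> (g_ ^~ x) @ \oo --> g x) ->
  measurable_fun D g /\
  \int[mu]_(x in D) (w x * g_ n x) @[n --> \oo] -->
  \int[mu]_(x in D) (w x * g x).
Proof.
move=> mD iw mg_ gM gg.
have mg : measurable_fun D g by exact: (measurable_fun_cvg mg_).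
split=> //.
have mw : measurable_fun D w by apply/measurable_EFinP; exact: measurable_int iw.
have mwg n : measurable_fun D (EFin \o (fun x => w x * g_ n x)).
  by apply/measurable_EFinP; exact: measurable_funM.
have bnd n x : D x -> (`|(w x * g_ n x)%:E| <= (`|M * w x|)%:E)%E.
  move=> Dx; rewrite lee_fin !normrM mulrC ler_wpM2r//.
  by rewrite (le_trans (gM n _ Dx))// ler_norm.
have igM : mu.-integrable D (EFin \o (fun x => `|M * w x|)).
  have := integrable_abse (integrableZl mD M iw).
  by apply: eq_integrable => // x _ /=; rewrite EFinM.
have igfin : mu.-integrable D (EFin \o (fun x => w x * g x)).
  apply: (@integrable_mul_bounded _ _ _ M) => // x Dx.
  apply: (closed_cvg (fun y : R => y <= M) (@closed_le _ M) _ _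
    (cvg_norm (gg x Dx))).
  by apply: nearW => n; exact: gM.
have f_f : {ae mu, forall x, D x ->
    (fun n => (w x * g_ n x)%:E) @ \oo --> (w x * g x)%:E}.
  apply: aeW => x Dx; apply/fine_cvgP; split; first exact: nearW.
  by apply: cvgM; [exact: cvg_cst|exact: gg].
have f_g : {ae mu, forall x n, D x ->
    (`|(w x * g_ n x)%:E| <= (`|M * w x|)%:E)%E} by apply: aeW => x n; exact: bnd.
have [_ _ icvg] := dominated_convergence mD mwg (measurable_int _ igfin)
  f_f igM f_g.
rewrite /Rintegral; apply: fine_cvg; rewrite fineK//.
exact: integrable_fin_num igfin.
Qed.

End dominated_convergence_bounded.

Section finite_measure_integrals.
Context d (T : measurableType d) (R : realType).
Implicit Types (m : {measure set T -> \bar R}) (D : set T) (g : T -> R).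

Lemma bounded_integrable m D g (M : R) : measurable D -> (m D < +oo)%E ->
  measurable_fun D g -> (forall x, D x -> `|g x| <= M) ->
  m.-integrable D (EFin \o g).
Proof.
move=> mD fD mg gM; apply: measurable_bounded_integrable => //.
exists M; split; first exact: num_real.
by move=> y My t Dt /=; rewrite (le_trans (gM _ Dt))// ltW.
Qed.

Lemma integral_mscale m D (k : {nonneg R}) (f : T -> \bar R) : measurable D ->
  m.-integrable D f ->
  (\int[mscale k m]_(x in D) f x = k%:num%:E * \int[m]_(x in D) f x)%E.
Proof.
move=> mD intf; have mf := measurable_int _ intf.
rewrite [LHS]integralE [in RHS]integralE !ge0_integral_mscale//; last 2 first.
- exact: measurable_funeneg.
- exact: measurable_funepos.
by rewrite [RHS]muleBr//; exact: integrable_add_def.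
Qed.

End finite_measure_integrals.

(** * Total variation, signed integrals and displacement of a point mass *)

Section signed_measure_theory.
Context (R : realType).
Notation M := (measurableTypeR R).
Implicit Types (nu kappa : signed_measure R) (A D : set M) (g : R -> R).
Implicit Types (m : {measure set M -> \bar R}) (p q x : R).

Notation jpos nu := (jordan_pos (hahnP nu) : {measure set M -> \bar R}).
Notation jneg nu := (jordan_neg (hahnP nu) : {measure set M -> \bar R}).

Lemma mscale_diracE (k : {nonneg R}) x A :
  (mscale k (\d_(x : M)) : {measure set M -> \bar R}) A = (k%:num * (x \in A)%:R)%:E.
Proof. by rewrite EFinM -diracE. Qed.

Lemma add_measureE m1 m2 A :
  (measure_add m1 m2 : {measure set M -> \bar R}) A = (m1 A + m2 A)%E.
Proof. exact: measure_addE. Qed.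

Lemma jordanE nu A : measurable A -> nu A = (jpos nu A - jneg nu A)%E.
Proof. by move=> mA; rewrite (jordan_decomp (hahnP nu) mA) /cadd/= cscaleN1. Qed.

Lemma total_variationE nu A :
  total_variation_measure nu A = (jpos nu A + jneg nu A)%E.
Proof. by []. Qed.

Lemma total_variation_fin_num nu A : measurable A ->
  total_variation_measure nu A \is a fin_num.
Proof. by move=> mA; rewrite total_variationE fin_numD !fin_num_measure. Qed.

Lemma abse_le_total_variation nu A : measurable A ->
  (`|nu A| <= total_variation_measure nu A)%E.
Proof. exact: abse_charge_variation. Qed.

(** On a Hahn decomposition, the variation of [A] is the sum of [|nu|] over the positive and
    negative parts of [A]; the bound applies to each part and [m] is additive. *)
Lemma total_variation_le nu m A : measurable A ->
  (forall B, measurable B -> B `<=` A -> (`|nu B| <= m B)%E) ->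
  (total_variation_measure nu A <= m A)%E.
Proof.
move=> mA num; have [[mP _] [mN _] PNT PN0] := hahnP nu.
set P := hahn_pos nu in mP PNT PN0 *; set N := hahn_neg nu in mN PNT PN0 *.
have mAP : measurable (A `&` P) by exact: measurableI.
have mAN : measurable (A `&` N) by exact: measurableI.
have -> : m A = (m (A `&` P) + m (A `&` N))%E.
  rewrite -measureU//; first by rewrite -setIUr PNT setIT.
  by rewrite setIACA PN0 setI0.
rewrite total_variationE; apply: leeD.
  rewrite [leLHS]jordan_posE cjordan_posE /crestr0 mem_set//.
  by apply: le_trans (num _ mAP _); [exact: lee_abs|exact: subIsetl].
rewrite [leLHS]jordan_negE cjordan_negE /crestr0 mem_set//.
apply: le_trans (num _ mAN _); last exact: subIsetl.
by rewrite -abseN lee_abs.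
Qed.

(** A singleton has no subsets but itself and the empty set, so the Dirac mass at [x] with weight
    [|nu {x}|] dominates [nu] on all of them. *)
Lemma total_variation_set1 nu x :
  total_variation_measure nu [set x] = `|nu [set x]|%E.
Proof.
apply/eqP; rewrite eq_le abse_le_total_variation// andbT.
pose w := `|nu [set x]|%E; have w0 : (0 <= w)%E by exact: abse_ge0.
have wfin : w \is a fin_num by rewrite abse_fin_num fin_num_measure.
have fw0 : 0 <= fine w by exact: fine_ge0.
have := @total_variation_le nu (mscale (NngNum fw0) (\d_(x : M))) [set x]
  (measurable_set1 _).
rewrite mscale_diracE mem_set//= mulr1 fineK//; apply => B mB Bx.
have [|Bx0] := eqVneq B set0.
  by move=> ->; rewrite charge0 abse0 measure_ge0.
have -> : B = [set x].
  apply/seteqP; split=> // y ->; have /set0P[z Bz] := Bx0.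
  by have <- := Bx _ Bz.
by rewrite mscale_diracE mem_set//= mulr1 fineK.
Qed.

(** Any decomposition into finite positive measures computes the signed integral, not only Jordan's.
    If [nu = m1 - m2], the positive measures [jpos nu + m2] and [jneg nu + m1] agree, hence so do
    their integrals. *)
Lemma signed_integral_decomp nu m1 m2 D g (K : R) : measurable D ->
  measurable_fun D g -> (forall x, D x -> `|g x| <= K) ->
  m1.-integrable D (EFin \o g) -> m2.-integrable D (EFin \o g) ->
  (forall A, measurable A -> m1 A \is a fin_num) ->
  (forall A, measurable A -> m2 A \is a fin_num) ->
  (forall A, measurable A -> nu A = (m1 A - m2 A)%E) ->
  signed_integral nu D g = \int[m1]_(x in D) g x - \int[m2]_(x in D) g x.
Proof.
move=> mD mg gK i1 i2 fin1 fin2 nuE.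
have ip : (jpos nu).-integrable D (EFin \o g).
  by apply: (bounded_integrable _ _ mg gK) => //; rewrite ltey_eq fin_num_measure.
have ineg : (jneg nu).-integrable D (EFin \o g).
  by apply: (bounded_integrable _ _ mg gK) => //; rewrite ltey_eq fin_num_measure.
have : (\int[measure_add (jpos nu) m2]_(x in D) (g x)%:E =
        \int[measure_add (jneg nu) m1]_(x in D) (g x)%:E)%E.
  apply: eq_measure_integral => A mA _; rewrite !add_measureE.
  have := jordanE nu mA; rewrite nuE//.
  have : jpos nu A \is a fin_num by exact: fin_num_measure.
  have : jneg nu A \is a fin_num by exact: fin_num_measure.
  move: (fin1 _ mA) (fin2 _ mA).
  move=> /fineK <- /fineK <- /fineK <- /fineK <-.
  by rewrite -!EFinB -!EFinD => -[] ?; congr EFin; lra.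
rewrite !integral_measure_add//.
have F m : m.-integrable D (EFin \o g) ->
    (\int[m]_(x in D) (g x)%:E)%E = (\int[m]_(x in D) g x)%:E.
  by move=> im; rewrite /Rintegral fineK// (integrable_fin_num _ im).
rewrite /signed_integral !F// -!EFinD => -[].
have sub_swap (u v w z : R) : u + z = v + w -> u - v = w - z by lra.
exact: sub_swap.
Qed.

Lemma signed_integral_cvg nu D (g_ : nat -> R -> R) g (K : R) :
  measurable D -> (forall n, measurable_fun D (g_ n)) ->
  (forall n x, D x -> `|g_ n x| <= K) ->
  (forall x, D x -> (g_ ^~ x) @ \oo --> g x) ->
  signed_integral nu D (g_ n) @[n --> \oo] --> signed_integral nu D g.
Proof.
move=> mD mg gK gg.
have step m : (m D < +oo)%E ->
    \int[m]_(x in D) g_ n x @[n --> \oo] --> \int[m]_(x in D) g x.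
  move=> fD; have i1 : m.-integrable D (EFin \o cst (1 : R)).
    by apply: (@bounded_integrable _ _ _ _ _ _ 1) => // x _; rewrite normr1.
  have [_] := bounded_Rintegral_cvg mD i1 mg gK gg.
  by under eq_fun do under eq_Rintegral do rewrite mul1r;
     under eq_Rintegral do rewrite mul1r.
by apply: cvgB; apply: step; rewrite ltey_eq fin_num_measure.
Qed.

(** For [nu = Du], this is the derivative of the competitor [u + q * window p x]. *)
Definition move_mass nu q x p : signed_measure R :=
  cadd nu (cscale q (cadd (charge_of_finite_measure (\d_(p : M)))
                    (copp (charge_of_finite_measure (\d_(x : M)))))).

Lemma move_massE nu q x p A : move_mass nu q x p A =
  (nu A + q%:E * (\d_(p : M) A - \d_(x : M) A))%E.
Proof. by []. Qed.

Lemma signed_integral_move_mass nu q x p D g (K : R) : measurable D ->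
  measurable_fun D g -> (forall y, D y -> `|g y| <= K) -> D x -> D p ->
  signed_integral (move_mass nu q x p) D g =
  signed_integral nu D g + q * (g p - g x).
Proof.
move=> mD mg gK Dx Dp.
(* [q = (`|q| + q) - `|q|] avoids splitting on the sign of [q]. *)
have q1 : 0 <= `|q| + q by have := ler_norm (- q); rewrite normrN; lra.
pose dp := mscale (NngNum q1) (\d_(p : M)).
pose dp' := mscale (NngNum (normr_ge0 q)) (\d_(p : M)).
pose dx := mscale (NngNum (normr_ge0 q)) (\d_(x : M)).
pose dx' := mscale (NngNum q1) (\d_(x : M)).
have fin k y A : measurable A ->
    (mscale k (\d_(y : M)) : {measure set M -> \bar R}) A \is a fin_num.
  by move=> _; rewrite mscale_diracE.
have int m : (m D < +oo)%E -> m.-integrable D (EFin \o g).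
  by move=> fD; exact: (bounded_integrable _ _ mg gK).
have intf (m : {finite_measure set M -> \bar R}) : m.-integrable D (EFin \o g).
  by apply: int; rewrite ltey_eq fin_num_measure.
have Id k y : D y -> \int[mscale k (\d_(y : M))]_(t in D) g t = k%:num * g y.
  move=> Dy; rewrite /Rintegral integral_mscale//; last exact: intf.
  rewrite integral_dirac//; last exact/measurable_EFinP.
  by rewrite diracE mem_set// mul1e.
have Iadd m1 m2 : (m1 D < +oo)%E -> (m2 D < +oo)%E ->
    \int[measure_add m1 m2]_(t in D) g t =
    \int[m1]_(t in D) g t + \int[m2]_(t in D) g t.
  move=> f1 f2; rewrite /Rintegral integral_measure_add//; try exact: int.
  by rewrite fineD//; apply: integrable_fin_num => //; exact: int.
have lty (m : {finite_measure set M -> \bar R}) : (m D < +oo)%E.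
  by rewrite ltey_eq fin_num_measure.
have ltyD m1 m2 : (m1 D < +oo)%E -> (m2 D < +oo)%E ->
    ((measure_add m1 m2 : {measure set M -> \bar R}) D < +oo)%E.
  by move=> ? ?; rewrite add_measureE lte_add_pinfty.
rewrite (@signed_integral_decomp _ (measure_add (jpos nu) (measure_add dp dx))
  (measure_add (jneg nu) (measure_add dp' dx')) _ _ K)//.
- rewrite !Iadd//; try by rewrite ?ltyD// lty.
  by rewrite !Id//= /signed_integral; ring.
- by apply: int; rewrite !ltyD ?lty.
- by apply: int; rewrite !ltyD ?lty.
- by move=> A mA; rewrite !add_measureE !fin_numD fin_num_measure// !fin.
- by move=> A mA; rewrite !add_measureE !fin_numD fin_num_measure// !fin.
- move=> A mA; rewrite move_massE !diracE -EFinB -EFinM (jordanE _ mA).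
  rewrite !add_measureE !mscale_diracE.
  have : jpos nu A \is a fin_num by exact: fin_num_measure.
  have : jneg nu A \is a fin_num by exact: fin_num_measure.
  move=> /fineK <- /fineK <-; rewrite -!EFinB -!EFinD /=.
  by congr EFin; ring.
Qed.

(** The second hypothesis says that [q] lies between 0 and the atom of [nu] at [x], so that the atom
    loses exactly [|q|]. Away from [x] the variation gains at most [|q|] at [p]. Both sides are
    sums, which keeps every term a positive measure. *)
Lemma total_variation_move_mass nu q x p A : x != p ->
  `|fine (nu [set x]) - q| = `|fine (nu [set x])| - `|q| -> measurable A ->
  (total_variation_measure (move_mass nu q x p) A + `|q|%:E * \d_(x : M) A
   <= total_variation_measure nu A + `|q|%:E * \d_(p : M) A)%E.
Proof.
move=> xp Dq mA.
have away B : measurable B -> ~ B x ->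
    (total_variation_measure (move_mass nu q x p) B
     <= total_variation_measure nu B + `|q|%:E * \d_(p : M) B)%E.
  move=> mB Bx.
  have := @total_variation_le (move_mass nu q x p)
    (measure_add (total_variation_measure nu)
       (mscale (NngNum (normr_ge0 q)) (\d_(p : M)))) B mB.
  rewrite add_measureE mscale_diracE EFinM -diracE /=; apply => C mC CB.
  rewrite add_measureE mscale_diracE EFinM -diracE /= move_massE.
  rewrite [\d_(x : M) C](_ : _ = 0%E); last first.
    by rewrite diracE memNset// => /CB.
  rewrite sube0 (le_trans (lee_abs_add _ _))// leeD//.
    exact: abse_le_total_variation.
  by rewrite abseM diracE [X in (_ * X <= _)%E]gee0_abs// lee_fin.
case: (pselect (A x)) => Ax; last first.
  have x0 : (\d_(x : M) A = 0 :> \bar R)%E by rewrite diracE memNset.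
  by rewrite x0 mule0 adde0; exact: away.
have mx : measurable [set x] by exact: measurable_set1.
(* When [A] contains [x], the point is split off: its atom is computed exactly and the rest of [A]
   falls under the previous case. *)
have mAx : measurable (A `\ x) by exact: measurableD.
have split (m : {measure set M -> \bar R}) : m A = (m [set x] + m (A `\ x))%E.
  rewrite -measureU//; last by rewrite setDE setICA setICr setI0.
  by rewrite setDUK// => y ->.
have := away _ mAx (fun h => h.2 erefl).
rewrite (split (total_variation_measure nu)).
rewrite (split (total_variation_measure (move_mass nu q x p))).
rewrite !total_variation_set1 move_massE.
rewrite !diracE (mem_set Ax) (mem_set (erefl : [set x] x)).
rewrite [p \in [set x]]memNset; last by move=> /= px; rewrite px eqxx in xp.
have -> : (p \in A `\ x) = (p \in A).
  apply/idP/idP; rewrite !inE; first by case.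
  by move=> Ap; split=> // px; rewrite px eqxx in xp.
have := total_variation_fin_num (move_mass nu q x p) mAx.
have := total_variation_fin_num nu mAx.
have : nu [set x] \is a fin_num by exact: fin_num_measure.
move: Dq; case: (nu [set x]) => // D /= Dq _.
move=> /fineK <- /fineK <-.
rewrite mule1 -!EFinM -!EFinD !lee_fin sub0r mulrN1 Dq; lra.
Qed.

(** The inequality between measures is integrated against the nonnegative [alpha]; the Dirac masses
    added on either side contribute [|q| * alpha x] and [|q| * alpha p]. *)
Lemma integral_move_mass nu q x p D (alpha : R -> R) : x != p ->
  `|fine (nu [set x]) - q| = `|fine (nu [set x])| - `|q| -> measurable D ->
  D x -> D p -> measurable_fun D alpha -> (forall y, D y -> 0 <= alpha y) ->
  (\int[total_variation_measure (move_mass nu q x p)]_(y in D) (alpha y)%:E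
     + (`|q| * alpha x)%:E
   <= \int[total_variation_measure nu]_(y in D) (alpha y)%:E
     + (`|q| * alpha p)%:E)%E.
Proof.
move=> xp Dq mD Dx Dp malpha alpha0.
pose k := NngNum (normr_ge0 q).
have ma : measurable_fun D (EFin \o alpha) by exact/measurable_EFinP.
have a0 y : D y -> (0 <= (alpha y)%:E)%E by move=> Dy; rewrite lee_fin alpha0.
have I m y : D y ->
    (\int[measure_add m (mscale k (\d_(y : M)))]_(t in D) (alpha t)%:E =
     \int[m]_(t in D) (alpha t)%:E + (`|q| * alpha y)%:E)%E.
  move=> Dy; rewrite ge0_integral_measure_add// ge0_integral_mscale//.
  by rewrite integral_dirac// diracE mem_set// mul1e EFinM.
rewrite -!I// integral_mkcond [leRHS]integral_mkcond.
apply: ge0_le_measure_integral => //.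
- by move=> A mA; rewrite !add_measureE !mscale_diracE !EFinM -!diracE;
    exact: total_variation_move_mass.
- by move=> t; rewrite patchE; case: ifPn => // /set_mem; exact: a0.
- exact/(measurable_restrictT _ mD).
Qed.

End signed_measure_theory.

(** * Ramps and their smooth approximations *)

Section ramps.
Context (R : realType).
Notation mu := (@lebesgue_measure R).
Implicit Types (a b l s x y c d : R) (n : nat).

(** A smooth function vanishing outside []0, l[]. The dilation by [n.+1] sends both factors to 1
    inside, so the bumps tend pointwise to the indicator of []0, l[]. *)
Definition bump l n s : R :=
  flat_exp 0 (n.+1%:R * s) * flat_exp 0 (n.+1%:R * (l - s)).

Lemma bump_ge0 l n s : 0 <= bump l n s.
Proof. by rewrite mulr_ge0 ?flat_exp_ge0. Qed.

Lemma bump_le1 l n s : bump l n s <= 1.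
Proof. by rewrite mulr_ile1 ?flat_exp_ge0 ?flat_exp0_le1. Qed.

Lemma bump_out l n s : s \notin `]0, l[ -> bump l n s = 0.
Proof.
rewrite in_itv/= negb_and -!leNgt => /orP[s0|ls]; rewrite /bump.
  by rewrite flat_exp_le0 ?mul0r// pmulr_rle0.
by rewrite [X in _ * X]flat_exp_le0 ?mulr0// pmulr_rle0// subr_le0.
Qed.

Lemma flat_alg_bump l n c : flat_alg (fun s => bump l n (s - c)).
Proof.
rewrite (_ : (fun s => _) =
    fun s => flat_exp 0 (n.+1%:R * s + - n.+1%:R * c) *
             flat_exp 0 (- n.+1%:R * s + n.+1%:R * (l + c))); last first.
  by apply/funext => s; rewrite /bump; congr (flat_exp _ _ * flat_exp _ _); ring.
by apply: flat_algM; exact: flat_alg_exp.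
Qed.

Lemma cvg_bump l s : bump l ^~ s @ \oo --> ((s \in `]0, l[%R)%:R : R).
Proof.
case: (boolP (s \in _)) => [|sl]; last first.
  rewrite (_ : bump l ^~ s = cst 0); first exact: cvg_cst.
  by apply/funext => n; exact: bump_out.
rewrite in_itv/= => /andP[s0 sl].
have key t : 0 < t -> (fun n => flat_exp 0 (n.+1%:R * t)) @ \oo --> (1 : R).
  move=> t0; rewrite (_ : (fun n => _) =
      (fun n => expR (- (n.+1%:R^-1 * t^-1)))); last first.
    by apply/funext => n; rewrite /flat_exp mulr_gt0// expr0 invr1 mul1r invfM.
  rewrite -[X in _ --> X]expR0; apply: continuous_cvg.
    exact: continuous_expR.
  rewrite -[X in _ --> X]oppr0 -(mul0r t^-1); apply: cvgN; apply: cvgMl.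
  exact: cvg_harmonic.
rewrite -[X in _ --> X](mulr1 1); apply: cvgM; apply: key => //.
by rewrite subr_gt0.
Qed.

(** For [l >= 0], the primitive of the indicator of []0, l[] that vanishes on the negative
    half-line, hence the limit of the primitives of bumps. *)
Definition ramp l s : R := Num.min (Num.max s 0) l.

Lemma ramp_ge0 l s : 0 <= l -> 0 <= ramp l s.
Proof. by move=> l0; rewrite le_min l0 le_max lexx orbT. Qed.

Lemma ramp_le l s : ramp l s <= l.
Proof. by rewrite ge_min lexx orbT. Qed.

Lemma ramp0 l s : 0 <= l -> s <= 0 -> ramp l s = 0.
Proof. by move=> l0 s0; rewrite /ramp max_r// min_l. Qed.

Lemma ramp1 l s : 0 <= l -> l <= s -> ramp l s = l.
Proof. by move=> l0 ls; rewrite /ramp max_l ?min_r// (le_trans l0). Qed.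

Lemma continuous_bump l n : continuous (bump l n).
Proof.
have := flat_alg_smooth (flat_alg_bump l n 0).
rewrite (_ : (fun s => _) = bump l n); last by apply/funext => s; rewrite subr0.
by move=> sb; exact: (derivable_continuous (sb 0%N)).
Qed.

Lemma measurable_bump l n (D : set R) : measurable D ->
  measurable_fun D (bump l n).
Proof.
move=> mD; apply: measurable_funTS.
by apply: continuous_measurable_fun; exact: continuous_bump.
Qed.

Lemma bump_le_indic l n s : bump l n s <= \1_(`]0, l[) s.
Proof.
rewrite indicE; case: (boolP (s \in `]0, l[%R)) => sl.
  by rewrite mem_set ?bump_le1.
by rewrite bump_out.
Qed.

Lemma integrable_bump l n (D : set R) : measurable D ->
  mu.-integrable D (EFin \o bump l n).
Proof.
move=> mD; apply: (@integrableS _ _ _ mu setT) => //.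
apply: (le_integrable measurableT _ _ (integrable_indic_itv 0 l false true)).
  by apply/measurable_EFinP; exact: measurable_bump.
move=> s _ /=; rewrite lee_fin ger0_norm ?bump_ge0// ger0_norm//.
exact: bump_le_indic.
Qed.

Lemma Rintegral_indic_ramp l s : 0 <= l ->
  \int[mu]_(t in `]-oo, s]) (\1_(`]0, l[) t) = ramp l s.
Proof.
move=> l0; rewrite /Rintegral integral_indic//=.
have [s0|s0] := leP s 0.
  rewrite ramp0// (_ : _ `&` _ = set0) ?measure0//.
  apply/seteqP; split=> t //=; rewrite !in_itv/= => -[/andP[t0 _] ts]; lra.
have [ls|ls] := leP l s.
  rewrite ramp1// (_ : _ `&` _ = `]0, l[%classic); last first.
    apply/seteqP; split=> t /=; rewrite !in_itv/=; first by case.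
    by move=> /andP[t0 tl]; split; [rewrite t0|lra].
  rewrite lebesgue_measure_itv/= lte_fin; case: ltP => l0'.
    by rewrite oppr0 addr0.
  by rewrite /=; lra.
rewrite (_ : _ `&` _ = `]0, s]%classic); last first.
  apply/seteqP; split=> t /=; rewrite !in_itv/=.
    by move=> -[/andP[t0 _] ts]; rewrite t0.
  by move=> /andP[t0 ts]; split; [rewrite t0; lra|].
rewrite lebesgue_measure_itv/= lte_fin s0/= oppr0 addr0 /ramp max_l ?ltW//.
by rewrite min_l// ltW.
Qed.

Definition bump_primitive l n s := \int[mu]_(t in `]-oo, s]) bump l n t.

Lemma is_derive_bump_primitive l n s :
  is_derive s 1 (bump_primitive l n) (bump l n s).
Proof.
have s1 : s < s + 1 by rewrite ltrDl.
have [d1 d2] := @continuous_FTC1 R (bump l n) -oo%O s (s + 1) s1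
  (integrable_bump _ _ (measurable_itv _)) (ltNyr s) (@continuous_bump l n s).
by split=> //; rewrite -derive1E.
Qed.

Lemma bump_primitive_ge0 l n s : 0 <= bump_primitive l n s.
Proof. by apply: Rintegral_ge0 => t _; exact: bump_ge0. Qed.

Lemma bump_primitive_le l n s : 0 <= l -> bump_primitive l n s <= ramp l s.
Proof.
move=> l0; rewrite -Rintegral_indic_ramp//; apply: le_Rintegral => //.
- exact: integrable_bump.
- by apply: (@integrableS _ _ _ mu setT) => //; exact: integrable_indic_itv.
- by move=> t _; exact: bump_le_indic.
Qed.

Lemma bump_primitive_le0 l n s : 0 <= l -> s <= 0 -> bump_primitive l n s = 0.
Proof.
move=> l0 s0; apply/eqP; rewrite eq_le bump_primitive_ge0 andbT.
by rewrite (le_trans (bump_primitive_le _ _ l0))// ramp0.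
Qed.

Lemma bump_primitive_ge l n s : l <= s ->
  bump_primitive l n s = bump_primitive l n l.
Proof.
move=> ls; rewrite /bump_primitive Rintegral_mkcond [RHS]Rintegral_mkcond.
congr Rintegral; apply/funext => t; rewrite !patchE !mem_setE !in_itv/=.
have [tl|tl] := leP t l; first by rewrite (le_trans tl).
by case: ifP => // _; rewrite bump_out// in_itv/= negb_and -!leNgt (ltW tl) orbT.
Qed.

Lemma cvg_bump_primitive l s : 0 <= l ->
  bump_primitive l ^~ s @ \oo --> ramp l s.
Proof.
move=> l0; rewrite -Rintegral_indic_ramp//.
have iI : mu.-integrable `]-oo, s] (EFin \o \1_(`]0, l[)).
  by apply: (@integrableS _ _ _ mu setT) => //; exact: integrable_indic_itv.
(* The half-line has infinite measure, so the indicator of []0, l[] is inserted as an integrable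
   weight; it changes nothing for functions that vanish outside that interval. *)
have eqI g : (forall t, t \notin `]0, l[ -> g t = 0) ->
    \int[mu]_(t in `]-oo, s]) g t =
    \int[mu]_(t in `]-oo, s]) (\1_(`]0, l[) t * g t).
  move=> g0; apply: eq_Rintegral => t _; rewrite indicE.
  case: (boolP (t \in `]0, l[%R)) => tl; first by rewrite mem_set ?mul1r.
  by rewrite g0// mulr0.
rewrite (eqI (\1_(`]0, l[))); last first.
  by move=> t tl; rewrite indicE memNset//=; exact/negP.
rewrite (_ : bump_primitive l ^~ s = fun n =>
    \int[mu]_(t in `]-oo, s]) (\1_(`]0, l[) t * bump l n t)); last first.
  by apply/funext => n; rewrite -eqI// => t; exact: bump_out.
apply: (@bounded_Rintegral_cvg _ _ _ mu _ _ _ _ 1 _ iI _ _ _).2 => //.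
- by move=> n; exact: measurable_bump.
- by move=> n t _; rewrite ger0_norm ?bump_ge0 ?bump_le1.
- by move=> t _; rewrite indicE mem_setE; exact: cvg_bump.
Qed.

(** For [c <= d] and [l >= 0] a nonnegative hat supported in [[c, d + l]]. With [d = c + l] it is
    the tent of height [l] centred at [d]; with [l] small it is [l] times a near indicator of []c,
    d]]. *)
Definition trapezoid l c d y := ramp l (y - c) - ramp l (y - d).

Definition trapezoid_slope l c d y : R :=
  (y - c \in `]0, l[)%:R - (y - d \in `]0, l[)%:R.

Definition smooth_trapezoid l c d n y :=
  bump_primitive l n (y - c) - bump_primitive l n (y - d).

Lemma is_derive_smooth_trapezoid l c d n y :
  is_derive y 1 (smooth_trapezoid l c d n) (bump l n (y - c) - bump l n (y - d)).
Proof.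
have dB k : is_derive y 1 (fun y => bump_primitive l n (y - k)) (bump l n (y - k)).
  rewrite -[X in is_derive _ _ _ X]mulr1; apply: is_derive1_comp.
    exact: is_derive_bump_primitive.
  exact: is_derive_shift.
exact: (is_deriveB (dB c) (dB d)).
Qed.

Lemma derive1_smooth_trapezoid l c d n y :
  derive1 (smooth_trapezoid l c d n) y = bump l n (y - c) - bump l n (y - d).
Proof.
have D := is_derive_smooth_trapezoid l c d n y.
by rewrite derive1E derive_val.
Qed.

Lemma norm_subr_le (u v M : R) : 0 <= u <= M -> 0 <= v <= M -> `|u - v| <= M.
Proof. by move=> /andP[u0 uM] /andP[v0 vM]; rewrite ler_norml; lra. Qed.

Lemma trapezoid_bound l c d y : 0 <= l -> `|trapezoid l c d y| <= l.
Proof. by move=> l0; apply: norm_subr_le; rewrite ramp_ge0// ramp_le. Qed.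

Lemma smooth_trapezoid_bound l c d n y : 0 <= l ->
  `|smooth_trapezoid l c d n y| <= l.
Proof.
move=> l0; have B s : 0 <= bump_primitive l n s <= l.
  rewrite bump_primitive_ge0 (le_trans (bump_primitive_le _ _ l0))//.
  exact: ramp_le.
exact: norm_subr_le.
Qed.

Lemma derive1_smooth_trapezoid_bound l c d n y :
  `|derive1 (smooth_trapezoid l c d n) y| <= 1.
Proof.
by rewrite derive1_smooth_trapezoid norm_subr_le ?bump_ge0 ?bump_le1.
Qed.

Lemma cvg_smooth_trapezoid l c d y : 0 <= l ->
  smooth_trapezoid l c d ^~ y @ \oo --> trapezoid l c d y.
Proof. by move=> l0; apply: cvgB; exact: cvg_bump_primitive. Qed.

Lemma cvg_derive1_smooth_trapezoid l c d y :
  derive1 (smooth_trapezoid l c d n) y @[n --> \oo] --> trapezoid_slope l c d y.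
Proof.
under eq_fun do rewrite derive1_smooth_trapezoid.
by apply: cvgB; exact: cvg_bump.
Qed.

(** Left of [c] both primitives vanish, and right of [d + l] both have reached the same total mass,
    so their difference is supported in [[c, d + l]], inside []a, b[]. *)
Lemma smooth_trapezoid_test l c d n a b : 0 <= l -> a < c -> c <= d ->
  d + l < b -> test_function a b (smooth_trapezoid l c d n).
Proof.
move=> l0 ac cd db.
have supp : closure [set y | smooth_trapezoid l c d n y != 0] `<=` `[c, d + l].
  have : closed `[c, d + l]%classic by exact: itv_closed.
  rewrite closure_id => ->.
  apply: closure_subset => y /=; apply: contra_neqT.
  rewrite in_itv/= negb_and -!ltNge /smooth_trapezoid => /orP[yc|ly].
    by rewrite !bump_primitive_le0 ?subr0//; lra.
  by rewrite !(@bump_primitive_ge l n (y - _)) ?subrr//; lra.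
split.
- apply: (smooth_primitive _ (is_derive_smooth_trapezoid l c d n)).
  apply: flat_alg_smooth.
  rewrite (_ : (fun x => _) =
      fun y => bump l n (y - c) + (-1) * bump l n (y - d)); last first.
    by apply/funext => y; rewrite mulN1r.
  apply: flat_algD; first exact: flat_alg_bump.
  by apply: flat_algZ; exact: flat_alg_bump.
- apply: (subclosed_compact _ (@segment_compact _ c (d + l)) supp).
  exact: closed_closure.
- apply: (subset_trans supp) => y /=; rewrite !in_itv/= => /andP[cy yd].
  by apply/andP; split; lra.
Qed.

End ramps.

(** * Integration by parts against trapezoids *)

Section trapezoid_by_parts.
Context (R : realType).
Notation mu := (@lebesgue_measure R).
Implicit Types (a b c d l p x : R) (w g phi : R -> R).

Definition step p : R -> R := \1_(`]p, +oo[).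

(** A signed indicator: 1 on []p, x]] if [p < x], and -1 on []x, p]] if [x < p]. Its distributional
    derivative is the Dirac mass at [p] minus that at [x]. *)
Definition window p x y : R := step p y - step x y.

Lemma stepE p y : step p y = (p < y)%R%:R.
Proof. by rewrite /step indicE mem_setE in_itv/= andbT. Qed.

Lemma measurable_window p x (D : set R) : measurable D ->
  measurable_fun D (window p x).
Proof. by move=> mD; apply: measurable_funB; exact: measurable_indic. Qed.

Lemma window_bound p x y : `|window p x y| <= 1.
Proof.
rewrite /window !stepE.
by case: (p < y); case: (x < y);
  rewrite /= ?subrr ?subr0 ?sub0r ?normrN ?normr0 ?normr1.
Qed.

Lemma windowN p x y : window x p y = - window p x y.
Proof. by rewrite /window opprB. Qed.

Lemma integrable_window a b p x w :
  mu.-integrable `]a, b[ (EFin \o w) ->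
  mu.-integrable `]a, b[ (EFin \o (fun y => w y * window p x y)).
Proof.
move=> iw; apply: (@integrable_mul_bounded _ _ _ mu _ _ _ 1) => //.
- exact: measurable_window.
- by move=> y _; exact: window_bound.
Qed.

Lemma measurable_continuous g (D : set R) : measurable D -> continuous g ->
  measurable_fun D g.
Proof. by move=> mD cg; apply: measurable_funTS; exact: continuous_measurable_fun. Qed.

Lemma continuous_bounded g a b : continuous g ->
  exists K, forall y, y \in `[a, b] -> `|g y| <= K.
Proof.
move=> cg; have [ab|ba] := leP a b; last first.
  by exists 0 => y; rewrite in_itv/= => /andP[? ?]; lra.
have [|c _ cmax] := @EVT_max R (fun y => `|g y|) a b ab.
  apply: continuous_subspaceT => y.
  by apply: (@continuous_comp _ _ _ g (fun z : R => `|z|)); [exact: cg|exact: norm_continuous].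
by exists `|g c|.
Qed.

Lemma test_function_out a b phi y : test_function a b phi ->
  y \notin `]a, b[ -> phi y = 0.
Proof.
move=> [_ _ supp]; apply: contraNeq => py; apply: supp.
exact: subset_closure.
Qed.

Lemma test_function_continuous a b phi n : test_function a b phi ->
  continuous (derive1n n phi).
Proof. by move=> [sm _ _]; exact: smooth_continuous. Qed.

Lemma integrable_continuous g a b : continuous g ->
  mu.-integrable `]a, b[ (EFin \o g).
Proof.
move=> cg; apply: (@integrableS _ _ _ mu `[a, b]) => //.
  exact: subset_itv_oo_cc.
apply: continuous_compact_integrable; first exact: segment_compact.
exact: continuous_subspaceT.
Qed.

(** The derivative of [step p] is the Dirac mass at [p]: the integral is that of [phi'] over
    [[p, b]], and [phi b = 0]. *)
Lemma step_by_parts a b p phi : test_function a b phi -> p \in `]a, b[ ->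
  \int[mu]_(y in `]a, b[) (step p y * derive1 phi y) = - phi p.
Proof.
move=> tphi; rewrite in_itv/= => /andP[ap pb].
have cphi' : continuous (derive1 phi) := test_function_continuous (n := 1%N) tphi.
have cphi : continuous phi := test_function_continuous (n := 0%N) tphi.
have -> : \int[mu]_(y in `]a, b[) (step p y * derive1 phi y) =
          \int[mu]_(y in `[p, b]) derive1 phi y.
  rewrite -Rintegral_itv_obnd_cbnd; last first.
    apply: (@integrableS _ _ _ mu `[p, b]) => //.
      by apply: subset_itvr; rewrite bnd_simp.
    apply: continuous_compact_integrable; first exact: segment_compact.
    exact: continuous_subspaceT.
  rewrite -Rintegral_itv_bndo_bndc; last exact: integrable_continuous.
  have -> : `]p, b[%classic = `]a, b[%classic `&` `]p, +oo[%classic.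
    apply/seteqP; split=> y /=; rewrite !in_itv/= andbT.
      by move=> /andP[py yb]; split=> //; rewrite yb andbT; lra.
    by move=> [/andP[_ ->] ->].
  rewrite Rintegral_mkcondr; apply: eq_Rintegral => y _.
  rewrite patchE /step indicE; case: ifP => _; first by rewrite mul1r.
  by rewrite mul0r.
have := @continuous_FTC2 R (derive1 phi) phi p b pb.
rewrite /Rintegral => ->//=.
- by rewrite (test_function_out (y := b) tphi) ?sub0r// in_itv/= ltxx andbF.
- exact: continuous_subspaceT.
- split.
  + by move=> y _; case: tphi => /(_ 0%N).
  + by apply: cvg_at_right_filter; exact: cphi.
  + by apply: cvg_at_left_filter; exact: cphi.
Qed.

Lemma trapezoid_slope_window a b c d l w : mu.-integrable `]a, b[ (EFin \o w) ->
  0 <= l ->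
  \int[mu]_(y in `]a, b[) (w y * trapezoid_slope l c d y) =
  \int[mu]_(y in `]a, b[) (w y * (window c (c + l) y - window d (d + l) y)).
Proof.
move=> iw l0; congr fine.
have mw : measurable_fun `]a, b[ w.
  by apply/measurable_EFinP; exact: measurable_int iw.
have slopeE k y : y != k + l ->
    ((y - k \in `]0, l[%R)%:R : R) = window k (k + l) y.
  move=> yk; rewrite /window !stepE in_itv/= subr_gt0 ltrBlDl.
  have [ky|ky] := ltP k y; have [yl|yl] := ltP y (k + l) => /=.
  - by rewrite ltNge (ltW yl) subr0.
  - by rewrite lt_neqAle eq_sym yk yl subrr.
  - by rewrite ltNge (ltW yl) subr0.
  - by rewrite [k + l < y]ltNge [y <= _](_ : _ = true) ?subr0//; lra.
have mslope : measurable_fun `]a, b[ (trapezoid_slope l c d).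
  have mk k : measurable_fun `]a, b[ (fun y => (y - k \in `]0, l[%R)%:R : R).
    refine (@measurable_fun_cvg _ _ R _ (fun n (y:R) => bump l n (y - k)) _ _ _).
      move=> n; apply: measurable_continuous => // y.
      have sb := flat_alg_smooth (flat_alg_bump l n k).
      exact: (derivable_continuous (sb 0%N)).
    by move=> y _; exact: cvg_bump.
  by apply: measurable_funB; exact: mk.
apply: ae_eq_integral => //.
- by apply/measurable_EFinP; exact: measurable_funM.
- apply/measurable_EFinP; apply: measurable_funM => //.
  by apply: measurable_funB; exact: measurable_window.
(* The slopes are indicators of open intervals while windows contain their right ends; they differ
   at most at [c + l] and [d + l], a null set. *)
- exists ([set c + l] `|` [set d + l]); split.
  + by apply: measurableU.
  + by rewrite null_set_setU//; exact: lebesgue_measure_set1.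
  + move=> y /= yn; apply: contrapT => /not_orP[/eqP yc /eqP yd].
    by apply: yn => _; rewrite /trapezoid_slope !slopeE.
Qed.

Section smooth_approximation.
Variables (a b c d l : R).
Hypotheses (l0 : 0 <= l) (ac : a < c) (cd : c <= d) (db : d + l < b).

Let tst n := smooth_trapezoid_test n l0 ac cd db.

Let cont n k : continuous (derive1n k (smooth_trapezoid l c d n)).
Proof. exact: test_function_continuous (tst n). Qed.

Lemma smooth_trapezoid_slope_cvg w : mu.-integrable `]a, b[ (EFin \o w) ->
  \int[mu]_(y in `]a, b[) (w y * derive1 (smooth_trapezoid l c d n) y)
    @[n --> \oo] -->
  \int[mu]_(y in `]a, b[) (w y * (window c (c + l) y - window d (d + l) y)).
Proof.
move=> iw; rewrite -trapezoid_slope_window//.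
apply: (bounded_Rintegral_cvg (M := 1) _ iw _ _ _).2 => //.
- move=> n; apply: measurable_continuous => //; exact: (@cont n 1%N).
- by move=> n y _; exact: derive1_smooth_trapezoid_bound.
- by move=> y _; exact: cvg_derive1_smooth_trapezoid.
Qed.

(** A trapezoid is only piecewise affine, hence not a test function. The definition is applied to
    its smooth approximations, and both sides pass to the limit by dominated convergence. *)
Lemma BV_trapezoid_by_parts w (Dw : signed_measure R) : BV_derivative a b w Dw ->
  \int[mu]_(y in `]a, b[) (w y * (window c (c + l) y - window d (d + l) y)) =
  - signed_integral Dw `]a, b[ (trapezoid l c d).
Proof.
move=> [iw _ parts].
have cv := smooth_trapezoid_slope_cvg iw.
have := @signed_integral_cvg R Dw `]a, b[ (smooth_trapezoid l c d)
  (trapezoid l c d) l (measurable_itv _)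
  (fun n => measurable_continuous (measurable_itv _) (@cont n 0%N))
  (fun n y _ => @smooth_trapezoid_bound R l c d n y l0)
  (fun y _ => @cvg_smooth_trapezoid R l c d y l0).
rewrite -(cvg_lim (@Rhausdorff R) cv) => /cvgN cv'.
apply: (cvg_lim (@Rhausdorff R)); apply: cvg_trans cv'.
by apply: near_eq_cvg; apply: nearW => n /=; rewrite parts.
Qed.

Lemma weak_trapezoid_by_parts w w' : weak_derivative a b w w' ->
  mu.-integrable `]a, b[ (EFin \o w) -> mu.-integrable `]a, b[ (EFin \o w') ->
  \int[mu]_(y in `]a, b[) (w y * (window c (c + l) y - window d (d + l) y)) =
  - \int[mu]_(y in `]a, b[) (w' y * trapezoid l c d y).
Proof.
move=> [_ _ parts] iw iw'.
have cv := smooth_trapezoid_slope_cvg iw.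
have [_] := @bounded_Rintegral_cvg _ _ _ mu `]a, b[ w' (smooth_trapezoid l c d)
  (trapezoid l c d) l (measurable_itv _) iw'
  (fun n => measurable_continuous (measurable_itv _) (@cont n 0%N))
  (fun n y _ => @smooth_trapezoid_bound R l c d n y l0)
  (fun y _ => @cvg_smooth_trapezoid R l c d y l0).
rewrite -(cvg_lim (@Rhausdorff R) cv) => /cvgN cv'.
apply: (cvg_lim (@Rhausdorff R)); apply: cvg_trans cv'.
by apply: near_eq_cvg; apply: nearW => n /=; rewrite parts.
Qed.

End smooth_approximation.

Lemma measurable_trapezoid l c d (D : set R) : 0 <= l -> measurable D ->
  measurable_fun D (trapezoid l c d).
Proof.
move=> l0 mD.
apply: (@measurable_fun_cvg _ _ _ _ (smooth_trapezoid l c d)).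
  move=> n; apply: measurable_continuous => //; apply: derivable_continuous => y.
  by have D' := is_derive_smooth_trapezoid l c d n y; exact: ex_derive.
by move=> y _; exact: cvg_smooth_trapezoid.
Qed.

End trapezoid_by_parts.

(** * Limits of shrinking trapezoids and increments of the weight *)

Section increments.
Context (R : realType).
Notation mu := (@lebesgue_measure R).
Implicit Types (a b c d l p x y : R) (w alpha : R -> R).

Lemma near_div_le l y : 0 < y -> \forall n \near \oo, l / n.+1%:R <= y.
Proof.
move=> y0; have cv : (fun n => l * n.+1%:R^-1) @ \oo --> (0 : R).
  by rewrite -(mulr0 l); apply: cvgMr; exact: cvg_harmonic.
by near=> n; near: n; apply: (cvgr_le (0 : R) cv).
Unshelve. all: by end_near. Qed.

(** The limit is attained: once [l / n.+1] is below [y - p], the scaled ramp equals 1 at [y], and it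
    is 0 for all [n] when [y <= p]. *)
Lemma scaled_ramp_near l p y : 0 < l -> \forall n \near \oo,
  ramp (l / n.+1%:R) (y - p) / (l / n.+1%:R) = step p y.
Proof.
move=> l0; have ln0 (n : nat) : 0 < l / n.+1%:R by rewrite divr_gt0.
rewrite stepE; have [py|yp] := ltP p y; last first.
  by apply: nearW => n; rewrite ramp0 ?mul0r ?(ltW (ln0 n))//; lra.
have yp0 : 0 < y - p by lra.
near=> n; rewrite ramp1 ?divff ?gt_eqF//; first exact: ltW.
by near: n; exact: near_div_le.
Unshelve. all: by end_near. Qed.

Lemma cvg_scaled_trapezoid l c d y : 0 < l ->
  (fun n => trapezoid (l / n.+1%:R) c d y / (l / n.+1%:R)) @ \oo -->
  window c d y.
Proof.
move=> l0; apply: cvg_near_cst; near=> n.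
rewrite /trapezoid mulrBl /window; congr (_ - _); near: n;
  exact: scaled_ramp_near.
Unshelve. all: by end_near. Qed.

Lemma scaled_trapezoid_bound c d l y : 0 < l -> `|trapezoid l c d y / l| <= 1.
Proof.
move=> l0; rewrite normrM normfV (gtr0_norm l0) ler_pdivrMr// mul1r.
exact/trapezoid_bound/ltW.
Qed.

(** At [x] the scaled tent is always 1; any other point eventually leaves its support. *)
Lemma cvg_scaled_tent l x y : 0 < l ->
  (fun n => trapezoid (l / n.+1%:R) (x - l / n.+1%:R) x y / (l / n.+1%:R))
    @ \oo --> (\1_[set x] y : R).
Proof.
move=> l0; have ln0 (n : nat) : 0 < l / n.+1%:R by rewrite divr_gt0.
apply: cvg_near_cst; rewrite indicE /trapezoid.
have [yx|xy|->] := ltgtP y x.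
- have yx0 : 0 < x - y by lra.
  near=> n; have lxy : l / n.+1%:R <= x - y by near: n; exact: near_div_le.
  rewrite memNset; last by move=> /= yx'; lra.
  rewrite !ramp0 ?subrr ?mul0r ?(ltW (ln0 n))//; move: lxy; set h := l / _; lra.
- have yx0 : 0 < y - x by lra.
  near=> n; have lxy : l / n.+1%:R <= y - x by near: n; exact: near_div_le.
  rewrite memNset; last by move=> /= yx'; lra.
  by rewrite !ramp1 ?subrr ?mul0r ?(ltW (ln0 n))//;
    move: lxy (ln0 n); set h := l / _; lra.
- apply: nearW => n; rewrite mem_set// subrr subKr.
  by rewrite ramp1 ?ramp0 ?(ltW (ln0 n))// subr0 divff// gt_eqF.
Unshelve. all: by end_near. Qed.

Lemma window_indic c d y : c <= d -> window c d y = \1_(`]c, d]) y.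
Proof.
move=> cd; rewrite /window !stepE indicE mem_setE in_itv/=.
have [cy|yc] := ltP c y; have [dy|yd] := ltP d y; rewrite /= ?subrr ?subr0//.
lra.
Qed.

Lemma window_ge0 c d y : c <= d -> 0 <= window c d y.
Proof. by move=> cd; rewrite window_indic. Qed.

Lemma Rintegral_window a b c d : a <= c -> c <= d -> d < b ->
  \int[mu]_(y in `]a, b[) window c d y = d - c.
Proof.
move=> ac cd db; under eq_Rintegral do rewrite window_indic//.
rewrite /Rintegral integral_indic//= (_ : _ `&` _ = `]c, d]%classic); last first.
  apply/seteqP; split=> y /=; rewrite !in_itv/=; first by case.
  by move=> /andP[cy yd]; split; apply/andP; split=> //; lra.
rewrite lebesgue_measure_itv/= lte_fin; case: ltP => // dc.
by rewrite /=; lra.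
Qed.

Lemma integrable_cst_itv a b (k : R) : mu.-integrable `]a, b[ (EFin \o cst k).
Proof. by apply: integrable_continuous => y; exact: cst_continuous. Qed.

Lemma within_continuous_integrable a b alpha :
  {within `[a, b], continuous alpha} ->
  mu.-integrable `]a, b[ (EFin \o alpha).
Proof.
move=> calpha; apply: (@integrableS _ _ _ mu `[a, b]) => //.
  exact: subset_itv_oo_cc.
by apply: continuous_compact_integrable => //; exact: segment_compact.
Qed.

Lemma cvg_window_average a b c l alpha : {within `[a, b], continuous alpha} ->
  a < c -> 0 < l -> c + l < b ->
  (fun n => (\int[mu]_(y in `]a, b[) (alpha y * window c (c + l / n.+1%:R) y))
            / (l / n.+1%:R)) @ \oo --> alpha c.
Proof.
move=> calpha ac l0 clb; have ialpha := within_continuous_integrable calpha.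
have ab : a < b by lra.
have cab : c \in `]a, b[ by rewrite in_itv/= ac/=; lra.
have [cc _ _] := (continuous_within_itvP alpha ab).1 calpha.
apply/cvgrPdist_le => e e0.
have [dl /= dl0 near_c] :=
  (nbhs_ballP _ _).1 (cvgr_dist_le alpha (alpha c) (cc c cab) e e0).
(* Half the continuity radius, so that points of the closed end of the window stay strictly within
   it. *)
near=> n; have hdl : l / n.+1%:R <= dl / 2.
  by near: n; apply: near_div_le; exact: divr_gt0.
have h0 : 0 < l / n.+1%:R by rewrite divr_gt0.
have hl : l / n.+1%:R <= l by rewrite ler_pdivrMr// ler_peMr ?ler1n// ltW.
move: (l / n.+1%:R) hdl h0 hl => h hdl h0 hl.
have ch : c <= c + h by lra.
have chb : c + h < b by lra.
(* The constants [alpha c] and, below, [e] are written as their own averages over the window, which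
   reduces the estimate to a pointwise one. *)
have -> : alpha c = (\int[mu]_(y in `]a, b[) (alpha c * window c (c + h) y)) / h.
  rewrite RintegralZl//; last first.
    have := integrable_window c (c + h) (integrable_cst_itv a b 1).
    by apply: eq_integrable => // y _ /=; rewrite mul1r.
  by rewrite Rintegral_window ?(ltW ac)// [c + h - c]addrC addKr mulfK// gt_eqF.
have iw (k : R -> R) : mu.-integrable `]a, b[ (EFin \o k) ->
    mu.-integrable `]a, b[ (EFin \o (fun y => k y * window c (c + h) y)).
  exact: integrable_window.
rewrite -mulrBl normrM (@gtr0_norm _ h^-1) ?invr_gt0// ler_pdivrMr//.
rewrite -RintegralB//; [|exact: (iw (cst (alpha c)) (integrable_cst_itv _ _ _))
                        |exact: iw].
have -> : e * h = \int[mu]_(y in `]a, b[) (e * window c (c + h) y).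
  rewrite RintegralZl//; last first.
    have := iw _ (integrable_cst_itv a b 1).
    by apply: eq_integrable => // y _ /=; rewrite mul1r.
  by rewrite Rintegral_window ?(ltW ac)// [c + h - c]addrC addKr.
under eq_Rintegral do rewrite -mulrBl.
have idiff : mu.-integrable `]a, b[
    (EFin \o (fun y => (alpha c - alpha y) * window c (c + h) y)).
  apply: (iw (fun y => alpha c - alpha y)).
  exact: (@integrableB _ _ _ mu _ _ _ _ (integrable_cst_itv a b (alpha c)) ialpha).
apply: le_trans (le_normr_Rintegral _ idiff) _ => //.
apply: le_Rintegral => //.
- have := integrable_abse idiff.
  exact.
- exact: (iw (cst e) (integrable_cst_itv _ _ _)).
- move=> y; rewrite /= in_itv/= => /andP[ay yb].
  rewrite normrM (ger0_norm (window_ge0 _ ch)) window_indic//.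
  rewrite indicE mem_setE in_itv/=.
  case: (boolP (_ && _)) => [/andP[cy ych]|]; last by rewrite !mulr0.
  rewrite !mulr1; apply: near_c; rewrite /ball/= ltr_norml; lra.
Unshelve. all: by end_near. Qed.

(** The fundamental theorem of calculus for a continuous function with integrable weak derivative.
    Trapezoids of height [h] divided by [h] tend to [window c d], while their slopes average [alpha]
    over intervals of length [h] to the right of [c] and of [d]; by continuity these averages tend
    to [alpha c] and [alpha d]. *)
Lemma weak_derivative_increment a b c d alpha alpha' :
  {within `[a, b], continuous alpha} -> weak_derivative a b alpha alpha' ->
  mu.-integrable `]a, b[ (EFin \o alpha') -> a < c -> c <= d -> d < b ->
  \int[mu]_(y in `]a, b[) (alpha' y * window c d y) = alpha d - alpha c.
Proof.
move=> calpha dalpha ialpha' ac cd db.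
have ialpha := within_continuous_integrable calpha.
(* Half the room left of [b] keeps every trapezoid supported inside []a, b[]. *)
pose l := (b - d) / 2; have l0 : 0 < l by rewrite /l; lra.
have dlb : d + l < b by rewrite /l; lra.
have clb : c + l < b by lra.
pose h (n : nat) := l / n.+1%:R.
have h0 n : 0 < h n by rewrite divr_gt0.
have hl n : h n <= l by rewrite ler_pdivrMr// ler_peMr ?ler1n// ltW.
have mT n : measurable_fun `]a, b[ (fun y => trapezoid (h n) c d y / h n).
  apply: measurable_funM => //; apply: measurable_trapezoid => //; exact: ltW.
have [_ cvR] := @bounded_Rintegral_cvg _ _ _ mu `]a, b[ alpha'
  (fun n y => trapezoid (h n) c d y / h n) (window c d) 1 (measurable_itv _)
  ialpha' mT (fun n y _ => @scaled_trapezoid_bound c d (h n) y (h0 n))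
  (fun y _ => @cvg_scaled_trapezoid l c d y l0).
pose J c (n : nat) :=
  (\int[mu]_(y in `]a, b[) (alpha y * window c (c + h n) y)) / h n.
have cvL : (fun n => - (J c n - J d n)) @ \oo --> alpha d - alpha c.
  rewrite -[alpha d - _]opprB; apply: cvgN; apply: cvgB.
    exact: cvg_window_average.
  by apply: cvg_window_average => //; exact: lt_le_trans cd.
rewrite -(cvg_lim (@Rhausdorff R) cvL); apply/esym/(cvg_lim (@Rhausdorff R)).
apply: cvg_trans cvR; apply: near_eq_cvg; apply: nearW => n; rewrite /J.
have dnb : d + h n < b by have := hl n; lra.
have := weak_trapezoid_by_parts (ltW (h0 n)) ac cd dnb dalpha ialpha ialpha'.
have iw k := integrable_window k (k + h n) ialpha.
under eq_Rintegral do rewrite mulrBr.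
rewrite RintegralB// => E.
rewrite -mulrBl E.
under eq_Rintegral do rewrite mulrA.
rewrite RintegralZr//; first by rewrite mulNr opprK.
apply: (@integrable_mul_bounded _ _ _ mu _ _ _ (h n)) => //.
- by apply: measurable_trapezoid => //; exact: ltW.
- by move=> y _; apply: trapezoid_bound; exact: ltW.
Qed.

End increments.

(** * First variation *)

Section first_variation.
Context (R : realType).
Notation mu := (@lebesgue_measure R).
Implicit Types (a b p q x : R) (f u alpha : R -> R) (Du : signed_measure R).

Lemma integrableZl_fun a b q (g : R -> R) : mu.-integrable `]a, b[ (EFin \o g) ->
  mu.-integrable `]a, b[ (EFin \o (fun y => q * g y)).
Proof. by move=> ig; exact: (@integrableZl _ _ _ mu _ _ q _ ig). Qed.

Lemma integrableD_fun a b (g k : R -> R) : mu.-integrable `]a, b[ (EFin \o g) ->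
  mu.-integrable `]a, b[ (EFin \o k) ->
  mu.-integrable `]a, b[ (EFin \o (fun y => g y + k y)).
Proof. by move=> ig ik; exact: (@integrableD _ _ _ mu _ _ _ _ ig ik). Qed.

Lemma EFin_Rintegral a b (g : R -> R) : mu.-integrable `]a, b[ (EFin \o g) ->
  (\int[mu]_(y in `]a, b[) (g y)%:E)%E = (\int[mu]_(y in `]a, b[) g y)%:E.
Proof. by move=> ig; rewrite fineK//; exact: integrable_fin_num ig. Qed.

Lemma BV_derivative_move_mass a b u Du q x p : BV_derivative a b u Du ->
  x \in `]a, b[ -> p \in `]a, b[ ->
  BV_derivative a b (fun y => u y + q * window p x y) (move_mass Du q x p).
Proof.
move=> [iu Du0 parts] xab pab.
have iw g : mu.-integrable `]a, b[ (EFin \o g) ->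
    mu.-integrable `]a, b[ (EFin \o (fun y => q * (window p x y * g y))).
  move=> ig.
  have : mu.-integrable `]a, b[ (EFin \o (fun y => g y * (q * window p x y))).
    apply: (@integrable_mul_bounded _ _ _ mu _ _ _ `|q|) => //.
      by apply: measurable_funM => //; exact: measurable_window.
    by move=> y _; rewrite normrM ler_piMr// window_bound.
  by apply: eq_integrable => // y _ /=; congr EFin; ring.
split.
- have iqw : mu.-integrable `]a, b[ (EFin \o (fun y => q * window p x y)).
    have := iw _ (integrable_cst_itv a b 1).
    by apply: eq_integrable => // y _ /=; rewrite mulr1.
  exact: (@integrableD _ _ _ mu _ _ _ _ iu iqw).
- move=> A mA A0; rewrite move_massE Du0// !diracE.
  have out y : y \in `]a, b[ -> y \in A = false.
    move=> yab; apply/negbTE/negP => /set_mem Ay.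
    by have : set0 y by rewrite -A0.
  by rewrite !out// subee// mule0 adde0.
- move=> phi tphi.
  have cphi : continuous phi := test_function_continuous (n := 0%N) tphi.
  have cphi' : continuous (derive1 phi) := test_function_continuous (n := 1%N) tphi.
  have iphi' := integrable_continuous a b cphi'.
  have [K phiK] := continuous_bounded a b cphi.
  rewrite (@signed_integral_move_mass _ _ _ _ _ _ _ K)//; last 2 first.
  - exact: measurable_continuous.
  - by move=> y yab; apply: phiK; exact: subset_itv_oo_cc yab.
  have mphi' : measurable_fun `]a, b[ (derive1 phi) by exact: measurable_continuous.
  have [K' phi'K] := continuous_bounded a b cphi'.
  have iuphi' : mu.-integrable `]a, b[ (EFin \o (fun y => u y * derive1 phi y)).
    apply: (@integrable_mul_bounded _ _ _ mu _ _ _ K') => // y yab.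
    by apply: phi'K; exact: subset_itv_oo_cc yab.
  have istep k : mu.-integrable `]a, b[ (EFin \o (fun y => step k y * derive1 phi y)).
    have : mu.-integrable `]a, b[ (EFin \o (fun y => derive1 phi y * step k y)).
      apply: (@integrable_mul_bounded _ _ _ mu _ _ _ 1) => //.
        exact: measurable_indic.
      by move=> y _; rewrite stepE; case: (k < y); rewrite ?normr1 ?normr0.
    by apply: eq_integrable => // y _ /=; rewrite mulrC.
  under eq_Rintegral do rewrite mulrDl -mulrA.
  rewrite RintegralD//; last exact: iw.
  rewrite parts// RintegralZl//; last first.
    have := integrable_window p x iphi'.
    by apply: eq_integrable => // y _ /=; rewrite mulrC.
  under [X in _ + _ * X]eq_Rintegral do rewrite /window mulrBl.
  by rewrite RintegralB// !step_by_parts//; ring.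
Qed.

(** Division by [W + 1] rather than [W] is licit when [W = 0]. If [X < 0], the chosen [t] satisfies
    [t * (W + 1) <= - X], hence [X + t * W <= - t < 0]. *)
Lemma ge0_of_small (X W D : R) : 0 < D -> 0 <= W ->
  (forall t : R, 0 < t -> t <= D -> 0 <= X + t * W) -> 0 <= X.
Proof.
move=> D0 W0 XW; rewrite leNgt; apply/negP => X0.
have W1 : 0 < W + 1 by lra.
have t0 : 0 < Num.min D (- X / (W + 1)).
  by rewrite lt_min D0 divr_gt0//; lra.
have := XW _ t0; rewrite ge_min lexx => /(_ isT).
have : Num.min D (- X / (W + 1)) * (W + 1) <= - X.
  by rewrite -ler_pdivlMr// ge_min lexx orbT.
move: t0; set t := Num.min _ _ => t0; lra.
Qed.

Lemma minimiser_first_variation a b f (Df : signed_measure R) alpha u Du x p :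
  a < b -> BV_derivative a b f Df -> {within `[a, b], continuous alpha} ->
  (forall y, y \in `[a, b] -> 0 < alpha y) -> minimiser a b f alpha u Du ->
  x \in `]a, b[ -> p \in `]a, b[ -> x != p -> fine (Du [set x]) != 0 ->
  alpha x - alpha p <=
  Num.sg (fine (Du [set x])) *
  \int[mu]_(y in `]a, b[) ((u y - f y) * window p x y).
Proof.
move=> ab bvf calpha alpha_gt0 [bvu umin] xab pab xp.
set D := fine _ => D0.
have [iu _ _] := bvu; have [if_ _ _] := bvf.
have oc y : y \in `]a, b[ -> y \in `[a, b] by exact: subset_itv_oo_cc.
have alpha0 y : `]a, b[%classic y -> 0 <= alpha y.
  by move=> yab; apply/ltW/alpha_gt0/oc.
have ialpha := within_continuous_integrable calpha.
have malpha : measurable_fun `]a, b[ alpha.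
  by apply/measurable_EFinP; exact: measurable_int ialpha.
have [M _ alphaM] := EVT_max (ltW ab) calpha.
have fin_alpha (nu : signed_measure R) :
    (\int[total_variation_measure nu]_(y in `]a, b[) (alpha y)%:E)%E
      \is a fin_num.
  apply: integrable_fin_num => //.
  apply: (@bounded_integrable _ _ _ _ _ _ (alpha M)) => //.
    by rewrite ltey_eq total_variation_fin_num.
  by move=> y yab; rewrite ger0_norm ?alpha0// alphaM// oc.
have mu_ : measurable_fun `]a, b[ u.
  by apply/measurable_EFinP; exact: measurable_int iu.
have mf : measurable_fun `]a, b[ f.
  by apply/measurable_EFinP; exact: measurable_int if_.
(* The competitor [f] has no fidelity term and finite energy, so minimality makes the fidelity term
   of [u] finite. The energies may then be compared as real numbers. *)
have isq : mu.-integrable `]a, b[ (EFin \o (fun y => (f y - u y) ^+ 2)).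
  apply/integrableP; split.
    apply/measurable_EFinP; apply: measurable_funX.
    exact: measurable_funB.
  have := umin _ _ bvf; rewrite /energy.
  under [X in (_ <= _ * X + _)%E]eq_integral do rewrite subrr expr0n/=.
  rewrite integral0 mule0 add0e.
  rewrite -(fineK (fin_alpha Df)) -(fineK (fin_alpha Du)) -leeBrDr//.
  rewrite -EFinB lee_pdivrMl// -EFinM => /le_lt_trans /(_ (ltry _)).
  by under [X in _ -> (X < _)%E]eq_integral do
    rewrite /= ger0_norm ?sqr_ge0//.
(* Comparison with the competitor for [q = s * t], after division by [t]: the weighted variation
   costs at most [alpha p - alpha x], and the square leaves a linear term and a remainder of order
   [t]. *)
have xpsg : forall t : R, 0 < t -> t <= `|D| ->
    0 <= (Num.sg D * (\int[mu]_(y in `]a, b[) ((u y - f y) * window p x y))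
      + alpha p - alpha x)
      + t * (2^-1 * \int[mu]_(y in `]a, b[) (window p x y ^+ 2)).
  move=> t t0 tD; pose q := Num.sg D * t.
  have normq : `|q| = t.
    by rewrite /q normrM normr_sg D0 mul1r gtr0_norm.
  (* As [t <= |D|], the atom [D - q = s * (|D| - t)] does not change sign. *)
  have Dq : `|D - q| = `|D| - `|q|.
    have -> : D - q = Num.sg D * (`|D| - t) by rewrite mulrBr -numEsg.
    by rewrite normrM normr_sg D0 mul1r normq ger0_norm ?subr_ge0.
  have ineq := @integral_move_mass R Du q x p `]a, b[ alpha xp Dq
    (measurable_itv _) xab pab malpha alpha0.
  have := umin _ _ (BV_derivative_move_mass q bvu xab pab).
  rewrite /energy.
  have isq2 : mu.-integrable `]a, b[ (EFin \o (fun y => window p x y ^+ 2)).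
    have := integrable_window p x (integrable_window p x (integrable_cst_itv a b 1)).
    by apply: eq_integrable => // y _ /=; rewrite mul1r expr2.
  have idiff : mu.-integrable `]a, b[ (EFin \o (fun y => u y - f y)).
    exact: (@integrableB _ _ _ mu _ _ _ _ iu if_).
  have iprod := integrable_window p x idiff.
  have expand : (\int[mu]_(y in `]a, b[)
        ((f y - (u y + q * window p x y)) ^+ 2)%:E)%E =
      (\int[mu]_(y in `]a, b[) (f y - u y) ^+ 2
       + ((2 * q) * \int[mu]_(y in `]a, b[) ((u y - f y) * window p x y)
       + q ^+ 2 * \int[mu]_(y in `]a, b[) (window p x y ^+ 2)))%:E.
    have i1 := integrableZl_fun (2 * q) iprod.
    have i2 := integrableZl_fun (q ^+ 2) isq2.
    rewrite -!RintegralZl// -RintegralD// -RintegralD//; last exact: integrableD_fun.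
    rewrite -EFin_Rintegral; last by do 2 apply: integrableD_fun => //.
    by apply: eq_integral => y _; congr EFin; ring.
  rewrite expand (EFin_Rintegral isq).
  move: ineq; rewrite -(fineK (fin_alpha Du)).
  rewrite -(fineK (fin_alpha (move_mass Du q x p))) -!EFinM -!EFinD !lee_fin.
  set B := fine _; set B' := fine _; set I2 := Rintegral _ _ _.
  set I1 := Rintegral _ _ _; set W := Rintegral _ _ _ => ineqB ineqE.
  have : 0 <= t * ((Num.sg D * I1 + alpha p - alpha x) + t * (2^-1 * W)).
    rewrite normq in ineqB.
    have q2 : q ^+ 2 = t ^+ 2.
      by rewrite /q exprMn sqr_sg D0 mul1r.
    have -> : t * (Num.sg D * I1 + alpha p - alpha x + t * (2^-1 * W)) =
       q * I1 + t * alpha p - t * alpha x + 2^-1 * (q ^+ 2 * W).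
      by rewrite q2 /q; ring.
    lra.
  by rewrite pmulr_rge0.
have := ge0_of_small _ _ xpsg; rewrite normr_gt0 => /(_ D0).
have W0 : 0 <= 2^-1 * \int[mu]_(y in `]a, b[) (window p x y ^+ 2).
  by rewrite mulr_ge0// Rintegral_ge0// => y _; exact: sqr_ge0.
by move=> /(_ W0); lra.
Qed.

End first_variation.

(** * From tents to atoms *)

Section atoms.
Context (R : realType).
Notation mu := (@lebesgue_measure R).
Implicit Types (a b h l x : R) (w g f alpha u : R -> R).
Implicit Types (nu Dw Df Du : signed_measure R).

Lemma signed_integralZr nu (D : set R) g (k K : R) : measurable D ->
  measurable_fun D g -> (forall y, D y -> `|g y| <= K) ->
  signed_integral nu D (fun y => g y * k) = signed_integral nu D g * k.
Proof.
move=> mD mg gK; rewrite /signed_integral !RintegralZr// ?mulrBl//.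
- by apply: (@bounded_integrable _ _ _ _ _ _ K) => //; rewrite ltey_eq fin_num_measure.
- by apply: (@bounded_integrable _ _ _ _ _ _ K) => //; rewrite ltey_eq fin_num_measure.
Qed.

Lemma signed_integral_set1 nu (D : set R) x : measurable D -> D x ->
  signed_integral nu D (\1_[set x]) = fine (nu [set x]).
Proof.
move=> mD Dx; have mx : measurable [set x] by exact: measurable_set1.
rewrite jordanE// fineB ?fin_num_measure//.
rewrite /signed_integral /Rintegral !integral_indic//.
by have -> : [set x] `&` D = [set x] by apply/setIidPl => y ->.
Qed.

(** The scaled tents are bounded by 1 and tend to the indicator of [{x}], so dominated convergence
    against the finite measure [Dw] isolates its atom. *)
Lemma cvg_tent_atom a b x l Dw : 0 < l -> x \in `]a, b[ ->
  (fun n => signed_integral Dw `]a, b[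
      (trapezoid (l / n.+1%:R) (x - l / n.+1%:R) x) / (l / n.+1%:R)) @ \oo -->
  fine (Dw [set x]).
Proof.
move=> l0 xab; have h0 (n : nat) : 0 < l / n.+1%:R by rewrite divr_gt0.
rewrite -(@signed_integral_set1 Dw `]a, b[)//.
have mT n : measurable_fun `]a, b[
    (trapezoid (l / n.+1%:R) (x - l / n.+1%:R) x).
  by apply: measurable_trapezoid => //; exact: ltW.
have := @signed_integral_cvg R Dw `]a, b[
  (fun n y => trapezoid (l / n.+1%:R) (x - l / n.+1%:R) x y / (l / n.+1%:R))
  (\1_[set x]) 1 (measurable_itv _) (fun n => measurable_funM (mT n) (measurable_cst _))
  (fun n y _ => scaled_trapezoid_bound _ _ _ (h0 n))
  (fun y _ => @cvg_scaled_tent R l x y l0).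
apply: cvg_trans; apply: near_eq_cvg; apply: nearW => n.
rewrite (@signed_integralZr _ _ _ _ (l / n.+1%:R))// => y _.
by apply: trapezoid_bound; exact: ltW.
Qed.

(** The first variations at [p = x - h] and [p = x + h] are added. The increments of [alpha] are
    integrals of [alpha'] over the two windows, and [window (x - h) x - window x (x + h)] is the
    slope of the tent; integrating by parts reverses the inequality. *)
Lemma minimiser_tent a b f Df alpha (alpha' : R -> R)
    (Dalpha' : signed_measure R) u Du x h :
  a < b -> BV_derivative a b f Df -> {within `[a, b], continuous alpha} ->
  (forall y, y \in `[a, b] -> 0 < alpha y) -> weak_derivative a b alpha alpha' ->
  BV_derivative a b alpha' Dalpha' -> minimiser a b f alpha u Du ->
  x \in `]a, b[ -> fine (Du [set x]) != 0 -> 0 < h -> a < x - h -> x + h < b ->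
  Num.sg (fine (Du [set x]))
    * signed_integral Du `]a, b[ (trapezoid h (x - h) x)
  <= Num.sg (fine (Du [set x]))
    * signed_integral Df `]a, b[ (trapezoid h (x - h) x)
  + signed_integral Dalpha' `]a, b[ (trapezoid h (x - h) x).
Proof.
move=> hab hf halpha_cont halpha_pos halpha' hDalpha' hu hx D0 h0 axh xhb.
have [ax xb] : a < x /\ x < b by move: hx; rewrite in_itv/= => /andP.
have [bvu _] := hu; have [iu _ _] := bvu; have [if_ _ _] := hf.
have [ialpha' _ _] := hDalpha'.
have xhx : x - h <= x by lra.
have xxh : x <= x + h by lra.
have neg : x != x - h by rewrite gt_eqF//; lra.
have pos : x != x + h by rewrite lt_eqF//; lra.
have hin : x - h \in `]a, b[ by rewrite in_itv/= axh/=; lra.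
have pin : x + h \in `]a, b[ by rewrite in_itv/= xhb andbT; lra.
have vl := minimiser_first_variation hab hf halpha_cont halpha_pos hu hx hin
  neg D0.
have vr := minimiser_first_variation hab hf halpha_cont halpha_pos hu hx pin
  pos D0.
have il := weak_derivative_increment halpha_cont halpha' ialpha' axh xhx xb.
have ir := weak_derivative_increment halpha_cont halpha' ialpha' ax xxh xhb.
have parts (w : R -> R) (Dw : signed_measure R) : BV_derivative a b w Dw ->
    signed_integral Dw `]a, b[ (trapezoid h (x - h) x) =
    \int[mu]_(y in `]a, b[) (w y * window x (x + h) y)
    - \int[mu]_(y in `]a, b[) (w y * window (x - h) x y).
  move=> bvw; have [iw _ _] := bvw.
  rewrite -[LHS]opprK -(BV_trapezoid_by_parts (ltW h0) axh xhx xhb bvw) subrK.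
  under eq_Rintegral do rewrite mulrBr.
  by rewrite RintegralB ?opprB//; exact: integrable_window.
have diff p y : \int[mu]_(t in `]a, b[) ((u t - f t) * window p y t) =
    \int[mu]_(t in `]a, b[) (u t * window p y t)
    - \int[mu]_(t in `]a, b[) (f t * window p y t).
  under eq_Rintegral do rewrite mulrBl.
  by rewrite RintegralB//; exact: integrable_window.
have flip (w : R -> R) : mu.-integrable `]a, b[ (EFin \o w) ->
    \int[mu]_(t in `]a, b[) (w t * window (x + h) x t) =
    - \int[mu]_(t in `]a, b[) (w t * window x (x + h) t).
  move=> iw; rewrite -mulN1r -RintegralZl//; last exact: integrable_window.
  by apply: eq_Rintegral => t _; rewrite windowN mulrN mulN1r.
rewrite (parts _ _ bvu) (parts _ _ hf) (parts _ _ hDalpha').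
move: il ir vl vr; rewrite !diff !flip//.
(* The six unknowns are the integrals of [u], [f] and [alpha'] over the left and right windows. *)
do 6 (set i := Rintegral _ _ _; move: i => ?).
lra.
Qed.

End atoms.

(** * The estimate of the jump of the minimiser *)

Theorem corollary3p8 (R : realType) (a b : R) (hab : a < b)
  (f : R -> R) (Df : signed_measure R) (hf : BV_derivative a b f Df)
  (alpha : R -> R) (halpha_cont : {within `[a, b], continuous alpha})
  (halpha_pos : forall y, y \in `[a, b] -> 0 < alpha y)
  (alpha' : R -> R) (halpha' : weak_derivative a b alpha alpha')
  (Dalpha' : signed_measure R) (hDalpha' : BV_derivative a b alpha' Dalpha')
  (u : R -> R) (Du : signed_measure R) (hu : minimiser a b f alpha u Du)
  (x : R) (hx : x \in `]a, b[)
  (hjump : (0 < total_variation_measure Df [set x])%E)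
  (hDalpha'_pos : (0 < Dalpha' [set x])%E) :
  (total_variation_measure Du [set x]
   <= total_variation_measure Df [set x] + Dalpha' [set x])%E.
Proof.
have mx : measurable ([set x] : set (measurableTypeR R)) by exact: measurable_set1.
have fin (nu : signed_measure R) : nu [set x] \is a fin_num.
  exact: fin_num_measure.
(* If [u] has no jump at [x], the left-hand side is 0 and the right-hand side nonnegative; otherwise
   the sign of the jump is 1 or -1. *)
have [D0|D0] := eqVneq (fine (Du [set x])) 0.
  rewrite [leLHS]total_variation_set1 -(fineK (fin Du)) D0 abse0.
  by rewrite adde_ge0// ltW.
have [ax xb] : a < x /\ x < b by move: hx; rewrite in_itv/= => /andP.
set s := Num.sg (fine (Du [set x])).
(* Half the distance from [x] to the boundary: tents of height at most [l] have their support inside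
   []a, b[]. *)
pose l := Num.min (x - a) (b - x) / 2.
have m0 : 0 < Num.min (x - a) (b - x) by rewrite lt_min !subr_gt0 ax.
have l0 : 0 < l by rewrite /l; lra.
have lxa : l < x - a.
  have : Num.min (x - a) (b - x) <= x - a by rewrite ge_min lexx.
  by rewrite /l; lra.
have lbx : l < b - x.
  have : Num.min (x - a) (b - x) <= b - x by rewrite ge_min lexx orbT.
  by rewrite /l; lra.
pose tent (n : nat) := trapezoid (l / n.+1%:R) (x - l / n.+1%:R) x.
have tent_ineq n : s * signed_integral Du `]a, b[ (tent n) <=
    s * signed_integral Df `]a, b[ (tent n) +
    signed_integral Dalpha' `]a, b[ (tent n).
  rewrite /tent; have h0 : 0 < l / n.+1%:R by rewrite divr_gt0.
  have hl : l / n.+1%:R <= l by rewrite ler_pdivrMr// ler_peMr ?ler1n// ltW.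
  move: (l / n.+1%:R) h0 hl => h h0 hl.
  by apply: (minimiser_tent hab hf halpha_cont halpha_pos halpha' hDalpha' hu
    hx D0 h0); lra.
pose quot (Dw : signed_measure R) n :=
  signed_integral Dw `]a, b[ (tent n) / (l / n.+1%:R).
have cvs Dw : (fun n => s * quot Dw n) @ \oo --> s * fine (Dw [set x]).
  by apply: cvgMr; exact: cvg_tent_atom.
have cvR : (fun n => s * quot Df n + quot Dalpha' n) @ \oo -->
    s * fine (Df [set x]) + fine (Dalpha' [set x]).
  by apply: cvgD; [exact: cvs|exact: cvg_tent_atom].
have atom_ineq : s * fine (Du [set x]) <=
    s * fine (Df [set x]) + fine (Dalpha' [set x]).
  apply: (ler_cvg_to (cvs Du) cvR); apply: nearW => n.
  have h0 : 0 < l / n.+1%:R by rewrite divr_gt0.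
  by rewrite /quot !mulrA -mulrDl ler_pM2r ?invr_gt0//; exact: tent_ineq.
rewrite [leLHS]total_variation_set1 total_variation_set1.
rewrite -(fineK (fin Du)) -(fineK (fin Df)) -(fineK (fin Dalpha')).
rewrite -EFinD lee_fin normrEsg -/s; apply: le_trans atom_ineq _.
(* Since [|s| = 1], [s * Df {x}] is at most [|Df {x}|], whatever the relative signs of the two
   jumps. *)
rewrite lerD2r (le_trans (ler_norm _))// normrM normr_sg D0 mul1r//.
Qed.
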